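(* Let $f(x) \in \mathbb{Z}[x]$ be a reducible quartic polynomial, i.e. a polynomial of degree exactly $4$ that is a product of two non-constant polynomials with integer coefficients. Then there exist infinitely many positive integers $n$ such that $f(n) \neq 0$ and $P^+(f(n)) < n$.
   Context: For a nonzero integer $m$, $P^+(m)$ denotes the largest prime factor of $m$, with the convention $P^+(\pm 1) = 1$. *)

(* Defs.v *)
From mathcomp Require Import all_boot all_order all_algebra.
Set Implicit Arguments.
Unset Strict Implicit.
Unset Printing Implicit Defensive.
Import Order.TTheory GRing.Theory Num.Theory.
Local Open Scope ring_scope.

(* P^+(m).  [max_pdiv 1 = 1], which is the convention P^+(1) = P^+(-1) = 1;
   the value at [m = 0] (also 1) is junk, so uses must assume [m != 0]. *)
Definition Pplus (m : int) : nat := max_pdiv `|m|%N.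

(* Non-constant means [1 < size], since [size] is the degree plus one. *)
Definition reducible_quartic (f : {poly int}) : Prop :=
  size f = 5%N /\
  exists g h : {poly int}, [/\ (1 < size g)%N, (1 < size h)%N & f = g * h].

(* Main.v *)
Require Import Defs.
From mathcomp Require Import all_boot all_order all_algebra.
From mathcomp Require Import zify ring.
Import Order.TTheory GRing.Theory Num.Theory.
Local Open Scope ring_scope.

(** It is enough to find an integer-valued polynomial [n(s)] such that [f(n(s))]
    is, up to a constant, a product of polynomials [U(s)] none of which has
    larger degree than [n(s)] ([smooth_values]).  Each [U(s)] is then at most a
    constant [K] times [n(s)], and the constant is harmless: fix [s1] at which
    every non-constant [U(s1)] exceeds [K] in absolute value and restrict [s] to
    a residue class of [s1] modulo the product of these values; then [U(s)] is
    [U(s1)], which is bounded, times a cofactor smaller than [n(s)].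

    Two splittings are needed, according to the degrees of the factors of [f].

    Linear times cubic.  A linear factor imposes nothing.  Let [t] be a root of
    the depressed cubic [c(x) = x^3 + 3Px + q], let [tau = u/v] be rational and
    [g = t^2 + tau t + (3P - tau^2)/2].  Then [g^2] has no [t^2] component: it
    is a linear expression in [t].  If [3a] is the trace of [g^2] and
    [z(s) = 2s^3 - 3as], then [z(g)^2 = g^2(2g^2 - 3a)^2] is again linear in
    [g^2], by the characteristic equation of [g^2], hence linear in [t].  So for
    a suitable rational polynomial [x(s)], affine in [z(s)^2], the difference
    [x(s) - t] is a constant times
      [z(s)^2 - z(g)^2 = (s^2 - g^2)(2s^2 + 2sg + 2g^2 - 3a)(2s^2 - 2sg + 2g^2 - 3a)],
    and its norm [c(x(s))] is a product of three polynomials of degree 6, the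
    degree of [x(s)] ([cubic_splitting]).

    Two quadratics [x^2 - D1] and [(x - 2E)^2 - D2].  The substitution
    [x = Y + (A/2)(Y^2 - D1)] splits the first one for every [A], and turns
    [x - 2E - sqrt D2] into a constant times [(1 + AY)^2 - delta] with
    [delta = 1 + A^2 D1 + 4AE + 2A sqrt D2].  If
    [delta = - W^2 (W^2 + h) / g^2] with [W] in [Q(sqrt D2)] and [g], [h]
    rational, then for [1 + AY = (g s^2 + h/g) / 2] one has
      [4 ((1 + AY)^2 - delta) = (g s^2 + (h + 2W^2)/g)^2 - (2Ws)^2],
    a product of two quadratics over [Q(sqrt D2)], whose norms have degree 4,
    the degree of [x].  For [W = r + sqrt D2] such [g] and [h] exist as soon as
    [1 + 4AE + A^2 D1 - A(r + D2/r)] is a square, a conic in [A] with the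
    rational point [A = 0]; it is used for [r = -1/w], [w] an auxiliary integer
    ([quadratics_splitting]).

    The polynomials obtained have denominators, and what remains is to make
    them take an integral value in a prescribed residue class.  By the Chinese
    remainder theorem ([root_mod_mul]) this is a question about each coprime
    factor of the denominator ([cubic_root], [quadratics_root]), and the
    parameters are chosen to make these questions solvable, the factors coprime,
    and the leading coefficient positive ([cubic_parameters], [quadratics_sign]).
    Where the choice breaks down the polynomial [f] is degenerate: the cubic has
    a double root, a quadratic is reducible, or the two quadratics are
    proportional. *)

(** * Growth and divisibility of polynomial values *)

Lemma horner_sub_dvd (p : {poly int}) (a b : int) : (a - b %| p.[a] - p.[b])%Z.
Proof.
elim/poly_ind: p => [|p c IH]; first by rewrite !horner0 subr0 dvdz0.
rewrite !hornerE.
have -> : p.[a] * a + c - (p.[b] * b + c) = (p.[a] - p.[b]) * a + p.[b] * (a - b).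
  by ring.
have h1 : (a - b %| (p.[a] - p.[b]) * a)%Z by apply: dvdz_mulr.
have h2 : (a - b %| p.[b] * (a - b))%Z by apply: dvdz_mull.
by rewrite rpredD.
Qed.

Lemma horner_le_pow {p : {poly int}} {k : nat} : (size p <= k.+1)%N ->
  exists2 C : int, 0 <= C & forall s : int, 1 <= s -> `|p.[s]| <= C * s ^+ k.
Proof.
elim: k p => [|k IH] p.
  move=> /size1_polyC ->; exists `|p`_0| => // s _.
  by rewrite hornerC expr0 mulr1.
elim/poly_ind: p => [|p c _] sp.
  by exists 0 => // s _; rewrite horner0 normr0 mul0r.
have [|C C0 HC] := IH p.
  move: sp; rewrite size_MXaddC; case: ifP => // /andP[/eqP -> _].
  by rewrite size_poly0.
exists (C + `|c|); first by rewrite addr_ge0.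
move=> s s1; rewrite !hornerE (le_trans (ler_normD _ _)) // mulrDl.
have s0 : 0 <= s by apply: le_trans s1.
apply: lerD; last by rewrite ler_peMr // exprn_ege1.
by rewrite normrM (ger0_norm s0) exprSr mulrA ler_wpM2r // HC.
Qed.

(** The factor 2 absorbs the lower-order terms, and [d] serves to fix the sign of
    the leading coefficient, which is at least 1 once positive. *)
Lemma pow_le_horner {p : {poly int}} {k : nat} {d : int} :
    (size p <= k.+1)%N -> 0 < d * p`_k ->
  exists S : int, forall s : int, S <= s -> s ^+ k <= 2 * (d * p.[s]).
Proof.
case: k => [|k] sp dl.
  exists 0 => s _; rewrite (size1_polyC sp) hornerC expr0.
  by lia.
pose q := p - p`_k.+1 *: 'X^(k.+1).
have sq : (size q <= k.+1)%N.
  apply/leq_sizeP => j; rewrite leq_eqVlt => /orP[/eqP <-|kj].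
    by rewrite coefB coefZ coefXn eqxx mulr1 subrr.
  rewrite coefB coefZ coefXn gtn_eqF // mulr0 subr0.
  by apply/leq_sizeP: kj.
have [C C0 HC] := horner_le_pow sq.
exists (1 + 2 * (`|d| * C)) => s Ss.
have s1 : 1 <= s.
  by apply: le_trans Ss; rewrite lerDl !mulr_ge0.
have -> : p = q + p`_k.+1 *: 'X^(k.+1) by rewrite subrK.
rewrite hornerD hornerZ hornerXn mulrDr mulrA exprS.
have := HC s s1.
have : 0 < s ^+ k by rewrite exprn_gt0 //; lia.
move: (s ^+ k) (q.[s]) => t y t0 Hy.
have h1 : `|d * y| <= `|d| * C * t by rewrite normrM -mulrA ler_wpM2l.
have h2 : s * t <= d * p`_k.+1 * (s * t).
  by rewrite ler_peMl //; nia.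
have h3 : 2 * (`|d| * C) * t <= s * t by rewrite ler_wpM2r //; lia.
have h4 : - (`|d| * C * t) <= d * y by move: h1; rewrite ler_norml => /andP[].
by nia.
Qed.

Lemma horner_large {p : {poly int}} (C : int) : (1 < size p)%N ->
  exists S : int, forall s : int, S <= s -> C < `|p.[s]|.
Proof.
move=> sp; have p0 : p != 0 by rewrite -size_poly_gt0; apply: leq_trans sp.
have [k sk] : exists k, size p = k.+2 by case: (size p) sp => [|[|k]] // _; exists k.
have l0 : lead_coef p != 0 by rewrite lead_coef_eq0.
have [||S HS] := @pow_le_horner p k.+1 (lead_coef p); first by rewrite sk.
  by rewrite lead_coefE sk /= -expr2 exprn_even_gt0 //= -[k.+1]/(k.+2.-1) -sk -lead_coefE.
exists (`|S| + 2 * (`|lead_coef p| * `|C|) + 1) => s Ss.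
have := HS s; set l := lead_coef p in l0 Ss *.
have h0 : 0 <= `|l| * `|C| by rewrite mulr_ge0.
have s1 : 1 <= s by lia.
have : s <= s ^+ k.+1 by rewrite exprS ler_peMr ?exprn_ege1 //; lia.
move: (s ^+ k.+1) (p.[s]) => t y st /(_ ltac:(lia)) H.
rewrite ltNge; apply/negP => yC.
have : `|l| * `|y| <= `|l| * `|C| by rewrite ler_wpM2l //; lia.
rewrite -normrM; move: (l * y) H => z; move: (`|l| * `|C|) h0 Ss => c; lia.
Qed.

Lemma horner_neq0_large {p : {poly int}} : p != 0 ->
  exists S : int, forall s : int, S <= s -> p.[s] != 0.
Proof.
move=> p0; case: (ltnP 1 (size p)) => sp.
  have [S HS] := horner_large 0 sp; exists S => s /HS; by rewrite normr_gt0.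
exists 0 => s _; rewrite (size1_polyC sp) hornerC.
by apply: contra p0 => /eqP e; rewrite (size1_polyC sp) e.
Qed.

(** * Smooth values from factorizations of bounded degree *)

Definition often_smooth (f : {poly int}) : Prop :=
  forall N : nat, exists n : nat,
    [/\ (N < n)%N, f.[n%:Z] != 0 & (Pplus f.[n%:Z] < n)%N].

Lemma Pplus_lt (m : int) (n : nat) : m != 0 -> (1 < n)%N ->
  (forall l, prime l -> (l %| absz m)%N -> (l < n)%N) -> (Pplus m < n)%N.
Proof.
move=> m0 n1 H; rewrite /Pplus; case: (ltnP 1 `|m|) => hm.
  by apply: H; [exact: max_pdiv_prime | exact: max_pdiv_dvd].
have -> : `|m|%N = 1%N by lia.
by rewrite /max_pdiv.
Qed.

Lemma prime_dvd_prod {l : nat} {s : int} {Us : seq {poly int}} : prime l ->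
  (l %| absz (\prod_(U <- Us) U.[s])%R)%N ->
  exists2 U, U \in Us & (l %| absz U.[s])%N.
Proof.
move=> pl; elim: Us => [|U Us IH].
  by rewrite big_nil dvdn1 => /eqP l1; rewrite l1 in pl.
rewrite big_cons abszM Euclid_dvdM // => /orP[h|/IH[V VU h]].
  by exists U; rewrite ?mem_head.
by exists V => //; rewrite inE VU orbT.
Qed.

Lemma eventually_all (Us : seq {poly int}) (R : {poly int} -> int -> Prop) :
  (forall U, U \in Us -> exists S : int, forall s : int, S <= s -> R U s) ->
  exists S : int, forall s : int, S <= s -> forall U, U \in Us -> R U s.
Proof.
elim: Us => [|U Us IH] H; first by exists 0.
have [|S1 H1] := IH; first by move=> V VU; apply: H; rewrite inE VU orbT.
have [|S2 H2] := H U; first exact: mem_head.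
exists (`|S1| + `|S2|) => s hs V; rewrite inE => /orP[/eqP ->|VU].
  by apply: H2; lia.
by apply: H1 => //; lia.
Qed.

Lemma common_bound (Us : seq {poly int}) (Q : {poly int} -> int -> Prop) :
  (forall U (C C' : int), C <= C' -> Q U C -> Q U C') ->
  (forall U, U \in Us -> exists2 C, 0 <= C & Q U C) ->
  exists2 C : int, 0 <= C & forall U, U \in Us -> Q U C.
Proof.
move=> mon; elim: Us => [|U Us IH] H; first by exists 0.
have [|C1 p1 H1] := IH; first by move=> V VU; apply: H; rewrite inE VU orbT.
have [|C2 p2 H2] := H U; first exact: mem_head.
exists (C1 + C2); first by lia.
move=> V; rewrite inE => /orP[/eqP ->|VU].
  by apply: mon H2; lia.
by apply: mon (H1 _ VU); lia.
Qed.

(** The argument [p] plays the role of [d * n]: the identity is only needed at the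
    points [s] where [p.[s]] is a multiple of [d], and it is enough that one such
    point [s0] exists.  All [s] used are congruent to [s0] modulo [d], and to a
    point [s1] modulo the values [U.[s1]] of the non-constant factors. *)
Lemma smooth_values (f p : {poly int}) (k : nat) (mu d s0 : int) (Us : seq {poly int}) :
    f != 0 -> mu != 0 -> (0 < k)%N -> (size p <= k.+1)%N -> 0 < d * p`_k ->
    (d %| p.[s0])%Z -> (forall U, U \in Us -> (size U <= k.+1)%N) ->
    (forall s n : int, p.[s] = d * n -> mu * f.[n] = \prod_(U <- Us) U.[s]) ->
  often_smooth f.
Proof.
move=> f0 mu0 k0 sp dl dp sU Hf N.
have d0 : d != 0 by apply: contraTneq dl => ->; rewrite mul0r ltxx.
have [Sp HSp] := pow_le_horner sp dl.
have [Sf HSf] := horner_neq0_large f0.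
have [C C0 HC] : exists2 C : int, 0 <= C & forall U, U \in Us ->
    forall s : int, 1 <= s -> `|U.[s]| <= C * s ^+ k.
  apply: (common_bound _ (fun U C => forall s, 1 <= s -> `|U.[s]| <= C * s ^+ k)).
    move=> U C C' CC' H s s1; apply: le_trans (H s s1) _.
    by rewrite ler_wpM2r // exprn_ge0 //; lia.
  by move=> U /sU /horner_le_pow.
pose K := C * 2 * (d * d).
have [S1 HS1] : exists S : int, forall s : int, S <= s -> forall U, U \in Us ->
    (size U <= 1)%N \/ ((1 < size U)%N /\ K < `|U.[s]|).
  apply: eventually_all => U _; case: (ltnP 1 (size U)) => h.
    by have [S HS] := horner_large K h; exists S => s /HS; right; split.
  by exists 0 => s _; left.
(* [s1] is congruent to [s0] modulo [d] and lies beyond the threshold [S1]. *)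
pose s1 := s0 + `|d| * (`|S1| + `|s0|).
have s1S : S1 <= s1.
  have : `|S1| + `|s0| <= `|d| * (`|S1| + `|s0|) by rewrite ler_peMl //; lia.
  by rewrite /s1; lia.
pose W := \prod_(U <- Us | (1 < size U)%N) U.[s1].
have K0 : 0 <= K by apply: mulr_ge0; [lia | rewrite -expr2 sqr_ge0].
have W0 : W != 0.
  rewrite /W prodf_seq_neq0; apply/allP => U UU; apply/implyP => h.
  case: (HS1 _ s1S U UU) => [|[_ hh]]; first by rewrite leqNgt h.
  by rewrite -normr_gt0; apply: le_lt_trans hh.
have [B B0 HB] : exists2 B : int, 0 <= B & forall U, U \in Us -> `|U.[s1]| <= B.
  apply: (common_bound _ (fun U C => `|U.[s1]| <= C)) => [U c c' cc' h|U _].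
    exact: le_trans cc'.
  by exists `|U.[s1]|.
(* A lower bound for [n] that settles all the requirements on its size. *)
pose m : int := `|Sp| + `|Sf| + N%:Z + B + 2.
have [mSp mSf mN mB] : [/\ Sp <= m, Sf <= m, N%:Z < m & B < m] by rewrite /m; split; lia.
have m2 : 2 <= m by rewrite /m; lia.
clearbody m.
pose s := s1 + `|d| * `|W| * (2 * (d * d) * m + `|s1| + m).
have d2 : 1 <= d * d.
  by have : 0 < d * d; [rewrite -expr2 exprn_even_gt0 | lia].
have dW : 1 <= `|d| * `|W| by rewrite -normrM -gtz0_ge1 normr_gt0 mulf_neq0.
have dm : 0 <= 2 * (d * d) * m by apply: mulr_ge0; lia.
have sb : 2 * (d * d) * m + m <= s.
  have : 2 * (d * d) * m + `|s1| + m <= `|d| * `|W| * (2 * (d * d) * m + `|s1| + m).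
    by apply: ler_peMl dW; lia.
  by rewrite /s; lia.
have ms : m <= s by lia.
have s1' : 1 <= s by lia.
have ds : (d %| s - s0)%Z.
  rewrite /s /s1; have -> : forall x y z w : int, s0 + x * y + x * z * w - s0 = x * (y + z * w).
    by move=> *; ring.
  by rewrite dvdz_mulr // dvdzE absz_id.
have Ws : (W %| s - s1)%Z.
  by rewrite /s addrAC subrr add0r dvdz_mulr // dvdz_mull // dvdzE absz_id.
clearbody s.
have dps : (d %| p.[s])%Z.
  rewrite -(subrK p.[s0] p.[s]) rpredD //.
  by apply: dvdz_trans (horner_sub_dvd _ _ _).
have [n pn] : exists n, p.[s] = d * n by have /dvdzP[n ->] := dps; exists n; rewrite mulrC.
have sk : s ^+ k <= 2 * (d * d) * n.
  by rewrite -!mulrA [X in d * X]mulrC [n * d]mulrC -pn; apply: HSp; apply: le_trans ms.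
have sk1 : s <= s ^+ k by rewrite -[k]prednK // exprS ler_peMr ?exprn_ege1 // (le_trans _ s1').
have mn : m <= n.
  have h : 2 * (d * d) * m <= 2 * (d * d) * n.
    apply: le_trans sk; apply: le_trans sk1; apply: le_trans sb.
    by rewrite lerDl; apply: le_trans m2.
  by move: h; rewrite ler_pM2l // mulr_gt0 //; apply: lt_le_trans d2.
have Hn := Hf s n pn.
have nn : n = `|n|%N by rewrite gez0_abs //; apply: le_trans mn; apply: le_trans m2.
have fn0 : f.[n] != 0 by apply: HSf; apply: le_trans mn.
exists `|n|%N; rewrite -nn; split=> //; first by rewrite -ltz_nat -nn (lt_le_trans mN).
apply: Pplus_lt => //; first by rewrite -ltz_nat -nn; apply: lt_le_trans mn; move: (m2); clear; lia.
move=> l pl lf.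
have : (l %| absz (\prod_(U <- Us) U.[s])%R)%N by rewrite -Hn abszM dvdn_mull.
have : \prod_(U <- Us) U.[s] != 0 by rewrite -Hn mulf_neq0.
rewrite prodf_seq_neq0 => /allP /= nz /(prime_dvd_prod pl)[U UU lU].
have {nz} Us0 : U.[s] != 0 by apply: nz UU.
have l_le : forall x : int, x != 0 -> (l %| absz x)%N -> l%:Z <= `|x|.
  by move=> x x0 h; rewrite -abszE lez_nat dvdn_leq // absz_gt0.
(* A constant factor is bounded by [B]; otherwise [U.[s1]] is split off. *)
have HBU := HB U UU.
case: (HS1 _ s1S U UU) => [sU1|[szU KU]].
  have := l_le _ Us0 lU; rewrite (size1_polyC sU1) hornerC.
  move: HBU; rewrite {1}(size1_polyC sU1) hornerC => h1 h2.
  by rewrite -ltz_nat -nn (lt_le_trans _ mn) // (le_lt_trans _ mB) // (le_trans h2).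
have [V UV] : exists V, U.[s] = U.[s1] * V.
  have : (U.[s1] %| U.[s])%Z.
    rewrite -(subrK U.[s1] U.[s]) rpredD ?dvdzz //.
    apply: dvdz_trans (horner_sub_dvd _ _ _).
    apply: dvdz_trans Ws.
    by rewrite /W (big_rem U) //= szU dvdz_mulr.
  by move=> /dvdzP[V ->]; exists V; rewrite mulrC.
have V0 : V != 0 by apply: contra Us0 => /eqP V0; rewrite UV V0 mulr0.
move: lU; rewrite UV abszM Euclid_dvdM // => /orP[lU|lV].
  have := l_le U.[s1] _ lU; rewrite -normr_gt0 (le_lt_trans K0 KU) => /(_ isT).
  move=> h; rewrite -ltz_nat -nn (lt_le_trans _ mn) // (le_lt_trans _ mB) //.
  exact: le_trans HBU.
have lV' := l_le V V0 lV.
have : `|U.[s]| <= K * n.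
  apply: le_trans (HC U UU s s1') _; rewrite /K -!mulrA ler_wpM2l //.
  by move: sk; rewrite -!mulrA.
have : K < `|U.[s1]| := KU.
rewrite UV normrM; move: (`|U.[s1]|) => x Kx xV.
rewrite -ltz_nat -nn; apply: le_lt_trans lV' _.
rewrite ltNge; apply/negP => nV.
have h1 : K * n <= K * `|V| by rewrite ler_wpM2l.
have h2 : K * `|V| < x * `|V| by rewrite ltr_pM2r // normr_gt0.
by move: (lt_le_trans (le_lt_trans h1 h2) xV); rewrite ltxx.
Qed.

(** * Coprimality and roots modulo products *)

Lemma coprimez_dvd {m n k : int} : (m %| n)%Z -> coprimez n k -> coprimez m k.
Proof. by rewrite dvdzE !coprimezE => /coprime_dvdl; apply. Qed.

Lemma coprimez_modl {m n : int} (k : int) : coprimez (n + k * m) m = coprimez n m.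
Proof. by rewrite /coprimez gcdzC addrC gcdzMDl gcdzC. Qed.

Lemma dvdz_sqr {m n : int} : (m ^+ 2 %| n ^+ 2)%Z -> (m %| n)%Z.
Proof. by rewrite !dvdzE !abszX dvdn_pexp2r. Qed.

Lemma dvd_horner {p : {poly int}} {m x y : int} :
  (m %| x - y)%Z -> (m %| p.[y])%Z -> (m %| p.[x])%Z.
Proof.
move=> xy py; rewrite -(subrK p.[y] p.[x]) rpredD //.
exact: dvdz_trans (horner_sub_dvd _ _ _).
Qed.

Lemma root_mod_mul {p : {poly int}} {m n : int} : coprimez m n ->
    (exists s, (m %| p.[s])%Z) -> (exists s, (n %| p.[s])%Z) ->
  exists s, (m * n %| p.[s])%Z.
Proof.
move=> mn [s ms] [t nt]; exists (zchinese m n s t).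
rewrite Gauss_dvdz //; apply/andP; split.
  by apply: dvd_horner ms; rewrite -eqz_mod_dvd zchinese_modl.
by apply: dvd_horner nt; rewrite -eqz_mod_dvd zchinese_modr.
Qed.


(** * A linear factor and a cubic factor *)

(** With [c(x) = x^3 + 3Px + q] and [tau = u/v], one has [b = v^3 c(tau)],
    [m = v^2 c'(tau) / 3], and [a] is a third of the trace of [g^2], where [g]
    is scaled by [2 v^2].  The polynomial [p] is the numerator of [x(s) - be]
    over the denominator [12 v b m H].  For [m] a root exists because [c] has
    the root [j/v] modulo [m]: by the hypothesis on [j], [m] divides
    [v^3 c(j/v) = m (2u + 3j)].  For [b] and [H] a root exists for every [tau],
    and modulo [v ^+ 2], which stands for all primes fixed in advance, the
    first-order term of [s] is adjusted to [be].  The divisibility of [v] by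
    [q ^+ 2 + 4 * P ^+ 3], which is the discriminant of [c] up to a constant,
    makes [b] and [m] coprime. *)
Lemma cubic_root (u v P q j be m b H a : int) (p : {poly int}) :
    m = u ^+ 2 + P * v ^+ 2 -> b = u ^+ 3 + 3 * P * v ^+ 2 * u + q * v ^+ 3 ->
    H = 81 * m ^+ 3 - 144 * u * b * m + 64 * b ^+ 2 -> a = 9 * m ^+ 2 - 8 * u * b ->
    coprimez u v -> (6 %| v)%Z -> (q ^+ 2 + 4 * P ^+ 3 %| v)%Z ->
    j ^+ 3 - 3 * u ^+ 2 * j + q * v ^+ 3 = 2 * u * m ->
    (forall s, p.[s] = 4 * (s ^+ 2 - a) ^+ 3 - 3 * a ^+ 2 * (s ^+ 2 - a)
        - 256 * (q * v ^+ 3) * b ^+ 3 - 12 * v * b * m * H * be) ->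
  exists s, (v ^+ 2 * (b * (m * H)) %| p.[s])%Z.
Proof.
move=> Em Eb EH Ea uv v6 vD Ej Ep.
have mv : coprimez m v.
  have -> : m = u ^+ 2 + (P * v) * v by rewrite Em; ring.
  by rewrite coprimez_modl coprimezXl.
have bv : coprimez b v.
  have -> : b = u ^+ 3 + (3 * P * v * u + q * v ^+ 2) * v by rewrite Eb; ring.
  by rewrite coprimez_modl coprimezXl.
have Hv : coprimez H v.
  have -> : H = u ^+ 6 + (51 * u ^+ 4 * P * v + 387 * u ^+ 2 * P ^+ 2 * v ^+ 3
      + 81 * P ^+ 3 * v ^+ 5 - 16 * q * v ^+ 2 * u ^+ 3 + 240 * P * q * u * v ^+ 4
      + 64 * q ^+ 2 * v ^+ 5) * v by rewrite EH Eb Em; ring.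
  by rewrite coprimez_modl coprimezXl.
(* The primes 2 and 3 divide [v]. *)
have cop2 x : coprimez x v -> coprimez 2 x.
  by rewrite coprimez_sym; apply: coprimez_dvd; apply: dvdz_trans v6.
have cop3 x : coprimez x v -> coprimez 3 x.
  by rewrite coprimez_sym; apply: coprimez_dvd; apply: dvdz_trans v6.
have bm : coprimez b m.
  suff : coprimez (b * (q * v ^+ 3 + 2 * u ^+ 3)) m by rewrite coprimezMl => /andP[].
  have -> : b * (q * v ^+ 3 + 2 * u ^+ 3) = v ^+ 6 * (q ^+ 2 + 4 * P ^+ 3)
      + (3 * u * (q * v ^+ 3 + 2 * u ^+ 3)
         - 4 * (u ^+ 4 - u ^+ 2 * P * v ^+ 2 + P ^+ 2 * v ^+ 4)) * m.
    by rewrite Eb Em; ring.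
  rewrite coprimez_modl; apply: (@coprimez_dvd _ (v ^+ 7)).
    by rewrite exprSr dvdz_mul.
  by rewrite coprimezXl // coprimez_sym.
have mb : coprimez m b by rewrite coprimez_sym.
have bH : coprimez H b.
  have -> : H = 81 * m ^+ 3 + (64 * b - 144 * u * m) * b by rewrite EH; ring.
  rewrite coprimez_modl coprimezMl [coprimez (m ^+ 3) _]coprimezXl // andbT.
  have -> : (81 : int) = 3 ^+ 4 by [].
  by rewrite coprimezXl // cop3.
have mH : coprimez H m.
  have -> : H = 64 * b ^+ 2 + (81 * m ^+ 2 - 144 * u * b) * m by rewrite EH; ring.
  rewrite coprimez_modl coprimezMl [coprimez (b ^+ 2) _]coprimezXl // andbT.
  have -> : (64 : int) = 2 ^+ 6 by [].
  by rewrite coprimezXl // cop2.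
have H16 : coprimez H 16.
  have -> : (16 : int) = 2 ^+ 4 by [].
  by rewrite coprimezXr // coprimez_sym cop2.
apply: root_mod_mul.
- by rewrite coprimez_sym coprimezXr // !coprimezMl bv mv Hv.
- exists (u ^+ 2 - 2 * v * u * be); rewrite Ep.
  have [al ea] : exists al, a = u ^+ 4 + v * al.
    exists (v * (9 * P ^+ 2 * v ^+ 2 - 6 * P * u ^+ 2 - 8 * q * u * v)).
    by rewrite Ea Em Eb; ring.
  have [ta et] : exists ta,
      (u ^+ 2 - 2 * v * u * be) ^+ 2 - a = v * (v * ta - 4 * u ^+ 3 * be).
    exists (4 * u ^+ 2 * be ^+ 2 + 6 * P * u ^+ 2 - 9 * P ^+ 2 * v ^+ 2 + 8 * q * u * v).
    by rewrite Ea Em Eb; ring.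
  have [ga eg] : exists ga, b * m * H = u ^+ 11 + v * ga.
    have [b1 e1] : exists b1, b = u ^+ 3 + v * b1.
      by exists (3 * P * v * u + q * v ^+ 2); rewrite Eb; ring.
    have [m1 e2] : exists m1, m = u ^+ 2 + v * m1 by exists (P * v); rewrite Em; ring.
    exists (81 * u ^+ 5 * (3 * u ^+ 4 * m1 + 3 * u ^+ 2 * v * m1 ^+ 2 + v ^+ 2 * m1 ^+ 3)
      - 144 * u ^+ 6 * (u ^+ 2 * b1 + u ^+ 3 * m1 + v * b1 * m1)
      + 64 * u ^+ 5 * (2 * u ^+ 3 * b1 + v * b1 ^+ 2)
      + (u ^+ 2 * b1 + u ^+ 3 * m1 + v * b1 * m1) * H).
    by rewrite EH e1 e2; ring.
  apply/dvdzP; exists (4 * v * (v * ta - 4 * u ^+ 3 * be) ^+ 3 - 3 * a ^+ 2 * ta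
    - 256 * q * v * b ^+ 3 + 12 * u ^+ 3 * be * (2 * u ^+ 4 * al + v * al ^+ 2)
    - 12 * be * ga).
  rewrite et; have -> : 12 * v * b * m * H * be = 12 * v * (b * m * H) * be by ring.
  by rewrite eg ea; ring.
apply: root_mod_mul.
- by rewrite coprimez_sym coprimezMl [coprimez m b]coprimez_sym bm.
- exists (3 * m); rewrite Ep.
  have -> : (3 * m) ^+ 2 - a = 8 * u * b by rewrite Ea; ring.
  apply/dvdzP.
  exists (2048 * u ^+ 3 * b ^+ 2 - 24 * a ^+ 2 * u - 256 * (q * v ^+ 3) * b ^+ 2
     - 12 * v * m * H * be); ring.
apply: root_mod_mul.
- by rewrite coprimez_sym.
- exists (2 * (j - u) * (j + 2 * u)); rewrite Ep.
  have eq : q * v ^+ 3 = 2 * u * m - j ^+ 3 + 3 * u ^+ 2 * j by rewrite -Ej; ring.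
  have [X eX] : exists X, (2 * (j - u) * (j + 2 * u)) ^+ 2 - a = m * X - 4 * j * b.
    exists (20 * u * (j + 2 * u) - 9 * m).
    have eb : b = 5 * u * m - (j - u) ^+ 2 * (j + 2 * u).
      have -> : b = 3 * u * m - 2 * u ^+ 3 + q * v ^+ 3 by rewrite Eb Em; ring.
      by rewrite eq; ring.
    by rewrite Ea eb; ring.
  rewrite eX eq {1}Ea; apply/dvdzP.
  set t := m * X - 4 * j * b.
  exists (4 * X * (t ^+ 2 - 4 * j * b * t + (4 * j * b) ^+ 2)
    - 3 * (a ^+ 2 * X - 4 * j * b * (81 * m ^+ 3 - 144 * u * b * m))
    - 512 * b ^+ 3 * u - 12 * v * b * H * be).
  by rewrite /t Ea; ring.
(* an inverse of 2 modulo the odd number H *)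
have [h eh] : exists h, (H %| 2 * h - 1)%Z.
  have /coprimezP[[h k] /= e] := cop2 _ Hv.
  by exists h; apply/dvdzP; exists (- k); rewrite mulNr -(addrK (k * H) (2 * h)) mulrC e; ring.
exists (3 * m * h).
(* Modulo [H] the number [4 t] is congruent to [32 u b - 27 m^2], and 16 times the
   value of [p] is a cubic polynomial in [4 t] that vanishes there. *)
rewrite -(@Gauss_dvdzr _ 16) // Ep.
set t := (3 * m * h) ^+ 2 - a.
have -> : 16 * (4 * t ^+ 3 - 3 * a ^+ 2 * t - 256 * (q * v ^+ 3) * b ^+ 3
     - 12 * v * b * m * H * be) =
   (4 * t - (32 * u * b - 27 * m ^+ 2)) * ((4 * t) ^+ 2 + 4 * t * (32 * u * b - 27 * m ^+ 2)
      + (32 * u * b - 27 * m ^+ 2) ^+ 2 - 12 * a ^+ 2)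
   + H * (81 * m ^+ 3 + 48 * u * m * b - 64 * b ^+ 2 - 192 * v * b * m * be).
  have eq : q * v ^+ 3 = b - 3 * u * m + 2 * u ^+ 3 by rewrite Eb Em; ring.
  by rewrite eq EH Ea; ring.
have -> : 4 * t - (32 * u * b - 27 * m ^+ 2) = (2 * h - 1) * (9 * m ^+ 2 * (2 * h + 1)).
  by rewrite /t Ea; ring.
by rewrite rpredD ?dvdz_mulr // -mulrA dvdz_mulr.
Qed.

(** Modulo [m = u^2 + P v^2] the number [tau = u/v] is a square root of [-P], so a
    root of [c] modulo [m] is a coincidence that has to be forced.  Trying
    [j = k u + l v] one finds that [j^3 - 3 u^2 j + q v^3] is, modulo [m], [v^2]
    times a linear form in [u], [v] whose coefficients depend on [k], [l],
    and [u/v] can be chosen to make that form vanish.  With [k = -1] and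
    [l = L/B] this gives [u/v = (L^3 + q B^3) / (B (3 L^2 + 2 P B^2))].  As [L]
    grows with [B] fixed so does [u/v], whence the last two bounds. *)
Lemma cubic_parameters (P q B : int) : 0 < B ->
  exists u v j : int, [/\ 0 < u, 0 < v, (B %| v)%Z & coprimez u v] /\
    [/\ j ^+ 3 - 3 * u ^+ 2 * j + q * v ^+ 3 = 2 * u * (u ^+ 2 + P * v ^+ 2),
        100 * `|P * v ^+ 2| <= u ^+ 2 & 100 * `|q * v ^+ 3| <= u ^+ 3].
Proof.
move=> B0.
pose Kk := 100 * (`|P| + `|q| + 1).
pose L := 1 + (3 * Kk + (2 * Kk * `|P| + `|q| + `|P|) * B ^+ 2) * B.
pose C := L ^+ 3 + q * B ^+ 3.
pose A := 3 * L ^+ 2 + 2 * P * B ^+ 2.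
have [K1 KP Kq] : [/\ 1 <= Kk, 100 * `|P| <= Kk & 100 * `|q| <= Kk].
  by rewrite /Kk; split; lia.
have P0 : 0 <= `|P| by []. have q0 : 0 <= `|q| by [].
have [B2 B3] : 0 < B ^+ 2 /\ 0 < B ^+ 3 by rewrite !exprn_gt0.
have [KB KPB] : 0 <= Kk * B /\ 0 <= Kk * `|P| * B ^+ 3.
  by rewrite !mulr_ge0 // ltW //; lia.
have [PB qB] : 0 <= `|P| * B ^+ 3 /\ 0 <= `|q| * B ^+ 3 by rewrite !mulr_ge0 // ltW.
have EL : L = 1 + 3 * (Kk * B) + 2 * (Kk * `|P| * B ^+ 3) + `|q| * B ^+ 3 + `|P| * B ^+ 3.
  by rewrite /L; ring.
have LB : coprimez L B by rewrite /L coprimez_modl coprimezE coprime1n.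
clearbody Kk L.
have L1 : 1 <= L.
  rewrite EL; move: KB KPB PB qB.
  by move: (Kk * B) (Kk * `|P| * B ^+ 3) (`|P| * B ^+ 3) (`|q| * B ^+ 3); clear; lia.
have L2 : 1 <= L ^+ 2 by rewrite exprn_ege1.
have LP : `|P| * B ^+ 2 <= L.
  apply: (@le_trans _ _ (`|P| * B ^+ 3)).
    by rewrite ler_wpM2l // (exprSr B 2) ler_peMr ?(ltW B2).
  rewrite EL; move: KB KPB PB qB.
  by move: (Kk * B) (Kk * `|P| * B ^+ 3) (`|P| * B ^+ 3) (`|q| * B ^+ 3); clear; lia.
have LL : L <= L ^+ 2 by rewrite expr2 ler_peMr // (le_trans _ L1).
have [hP hq] : `|P| * B ^+ 2 = `|P * B ^+ 2| /\ `|q| * B ^+ 3 = `|q * B ^+ 3|.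
  by rewrite (normrM P) (normrM q) (ger0_norm (ltW B2)) (ger0_norm (ltW B3)).
have A0 : 0 < A by rewrite /A -mulrA; lia.
have KA : Kk * (B * A) <= C.
  have h1 : (3 * (Kk * B) + (2 * (Kk * `|P| * B ^+ 3) + `|q| * B ^+ 3)) * L ^+ 2 <= L ^+ 3.
    rewrite [L ^+ 3]exprS ler_wpM2r ?(le_trans _ L2) // EL.
    by move: PB; move: (Kk * B) (Kk * `|P| * B ^+ 3) (`|P| * B ^+ 3) (`|q| * B ^+ 3); clear; lia.
  have h2 : 2 * (Kk * `|P| * B ^+ 3) + `|q| * B ^+ 3 <=
      (2 * (Kk * `|P| * B ^+ 3) + `|q| * B ^+ 3) * L ^+ 2.
    by rewrite ler_peMr // addr_ge0 // mulr_ge0.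
  have h3 : Kk * B * (P * B ^+ 2) <= Kk * `|P| * B ^+ 3.
    have -> : Kk * `|P| * B ^+ 3 = Kk * B * (`|P| * B ^+ 2) by ring.
    by rewrite ler_wpM2l // hP; lia.
  have -> : Kk * (B * A) = 3 * (Kk * B) * L ^+ 2 + 2 * (Kk * B * (P * B ^+ 2)).
    by rewrite /A; ring.
  have h12 : 3 * (Kk * B) * L ^+ 2 + (2 * (Kk * `|P| * B ^+ 3) + `|q| * B ^+ 3) <= L ^+ 3.
    by apply: le_trans h1; rewrite [leRHS]mulrDl lerD2l.
  have h4 : - (`|q| * B ^+ 3) <= q * B ^+ 3.
    by rewrite -mulNr ler_wpM2r ?(ltW B3) // lerNl ler_normr lexx orbT.
  rewrite /C; clear -h3 h12 h4; move: h3 h12 h4.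
  move: (3 * (Kk * B) * L ^+ 2) (Kk * B * (P * B ^+ 2)) (Kk * `|P| * B ^+ 3) => x y z.
  by move: (`|q| * B ^+ 3) (q * B ^+ 3) (L ^+ 3) => a b c; lia.
have C0 : 0 < C.
  by apply: lt_le_trans KA; rewrite !mulr_gt0 //; apply: lt_le_trans K1.
have CB : coprimez C B.
  have -> : C = L ^+ 3 + (q * B ^+ 2) * B by rewrite /C; ring.
  by rewrite coprimez_modl coprimezXl.
pose g := gcdz C A.
have g0 : 0 < g by rewrite /g lt_neqAle eq_sym gcdz_eq0 negb_and gt_eqF.
have [u Cu] : exists u, C = u * g by have /dvdzP[u ->] := dvdz_gcdl C A; exists u.
have [w Aw] : exists w, A = w * g by have /dvdzP[w ->] := dvdz_gcdr C A; exists w.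
have uw : coprimez u w.
  have : gcdz u w * `|g|%N = g by rewrite mulz_gcdl -Cu -Aw.
  rewrite gtz0_abs // => e; apply/eqP; apply: (mulIf (lt0r_neq0 g0)).
  by rewrite e mul1r.
have u0 : 0 < u by move: C0; rewrite Cu pmulr_lgt0.
have w0 : 0 < w by move: A0; rewrite Aw pmulr_lgt0.
have uKv : Kk * (B * w) <= u.
  rewrite -(ler_pM2r g0) -Cu.
  have -> : Kk * (B * w) * g = Kk * (B * A) by rewrite Aw; ring.
  by [].
have v0 : 0 < B * w by rewrite mulr_gt0.
have Kv0 : B * w <= Kk * (B * w) by rewrite ler_peMl // ltW.
exists u, (B * w), (L * w - u); split; split=> //.
- exact: dvdz_mulr.
- rewrite coprimez_sym coprimezMl; apply/andP; split.
    by rewrite coprimez_sym (coprimez_dvd _ CB) // Cu dvdz_mulr.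
  by rewrite coprimez_sym.
- have h : A * u = C * w by rewrite Aw Cu; ring.
  have -> : (L * w - u) ^+ 3 - 3 * u ^+ 2 * (L * w - u) + q * (B * w) ^+ 3 =
      w ^+ 2 * (C * w) - 3 * L ^+ 2 * w ^+ 2 * u + 2 * u ^+ 3 by rewrite /C; ring.
  by rewrite -h /A; ring.
- have -> : 100 * `|P * (B * w) ^+ 2| = 100 * `|P| * (B * w) ^+ 2.
    by rewrite normrM (ger0_norm (sqr_ge0 _)) mulrA.
  apply: le_trans (_ : Kk * (B * w) * (1 * (B * w)) <= _).
    have -> : Kk * (B * w) * (1 * (B * w)) = Kk * (B * w) ^+ 2 by ring.
    by rewrite ler_wpM2r ?sqr_ge0.
  by apply: ler_pM; rewrite ?mul1r ?(ltW v0) // ?(le_trans (ltW v0) Kv0) // (le_trans Kv0).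
- have -> : 100 * `|q * (B * w) ^+ 3| = 100 * `|q| * (B * w) ^+ 3.
    by rewrite normrM (ger0_norm (exprn_ge0 _ (ltW v0))) mulrA.
  apply: le_trans (_ : Kk * (B * w) * (B * w) ^+ 2 <= _).
    have -> : Kk * (B * w) * (B * w) ^+ 2 = Kk * (B * w) ^+ 3 by ring.
    by rewrite ler_wpM2r ?exprn_ge0 ?(ltW v0).
  rewrite [u ^+ 3]exprS; apply: ler_pM => //; last 1 first.
  - by rewrite lerXn2r ?nnegrE ?(ltW v0) ?(ltW u0) // (le_trans Kv0).
  - exact: le_trans (ltW v0) Kv0.
  - by rewrite sqr_ge0.
Qed.

(** For large [u] the three quantities are asymptotic to [u^2], [u^3] and [u^6];
    the constant 100 leaves room for all the lower-order terms. *)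
Lemma cubic_params_pos (u D e : int) : 0 < u -> 100 * `|D| <= u ^+ 2 -> 100 * `|e| <= u ^+ 3 ->
  let m := u ^+ 2 + D in let b := u ^+ 3 + 3 * D * u + e in
  [/\ 0 < m, 0 < b & 0 < 81 * m ^+ 3 - 144 * u * b * m + 64 * b ^+ 2].
Proof.
move=> u0 hD he m b.
have u2 : 0 < u ^+ 2 by rewrite exprn_gt0.
have u3 : 0 < u ^+ 3 by rewrite exprn_gt0.
split; rewrite /m /b.
- lia.
- have : 100 * (`|D| * u) <= u ^+ 3 by rewrite exprSr mulrA ler_wpM2r // ltW.
  have : - (`|D| * u) <= D * u by rewrite -mulNr ler_wpM2r ?(ltW u0) //; lia.
  by rewrite -mulrA; move: (D * u) (`|D| * u) => x y; lia.
have -> : 81 * (u ^+ 2 + D) ^+ 3 - 144 * u * (u ^+ 3 + 3 * D * u + e) * (u ^+ 2 + D)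
      + 64 * (u ^+ 3 + 3 * D * u + e) ^+ 2 =
    u ^+ 6 + 51 * (u ^+ 4 * D) + 387 * (u * D) ^+ 2 + 81 * D ^+ 3 - 16 * (u ^+ 3 * e)
      + 240 * (u * (D * e)) + 64 * e ^+ 2 by ring.
have h1 : 100 * `|u ^+ 4 * D| <= u ^+ 6.
  rewrite normrM mulrCA (ger0_norm (exprn_ge0 _ (ltW u0))) (exprD _ 4 2).
  by rewrite ler_wpM2l // exprn_ge0 // ltW.
have h2 : 100 * `|u ^+ 3 * e| <= u ^+ 6.
  rewrite normrM mulrCA (ger0_norm (exprn_ge0 _ (ltW u0))) (exprD _ 3 3).
  by rewrite ler_wpM2l // exprn_ge0 // ltW.
have h3 : 512 * `|D ^+ 3| <= u ^+ 6.
  have -> : 512 * `|D ^+ 3| = (8 * `|D|) ^+ 3 by rewrite normrX; ring.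
  have hD' : 8 * `|D| <= u ^+ 2 by apply: le_trans hD; rewrite ler_wpM2r.
  have -> : u ^+ 6 = (u ^+ 2) ^+ 3 by ring.
  by apply: lerXn2r => //; rewrite nnegrE ltW.
have h4 : 3200 * `|u * (D * e)| <= u ^+ 6.
  have -> : 3200 * `|u * (D * e)| = (32 * `|D|) * (100 * `|e|) * u.
    by rewrite !normrM (ger0_norm (ltW u0)); ring.
  have -> : u ^+ 6 = u ^+ 2 * u ^+ 3 * u by ring.
  have hD' : 32 * `|D| <= u ^+ 2 by apply: le_trans hD; rewrite ler_wpM2r.
  by rewrite ler_wpM2r ?(ltW u0) //; apply: ler_pM; rewrite ?mulr_ge0.
have u6 : 0 < u ^+ 6 by rewrite exprn_gt0.
have := sqr_ge0 (u * D); have := sqr_ge0 e.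
move: h1 h2 h3 h4 u6.
move: (u ^+ 4 * D) (u ^+ 3 * e) (D ^+ 3) (u * (D * e)) ((u * D) ^+ 2) (e ^+ 2) (u ^+ 6).
by clear=> x y z t a b c; lia.
Qed.

(** The norm of [2 s^2 + 2 e s g + 2 g^2 - 3 a], [e] a sign, for [g] a root of
    [(s + M)(s^2 - M^2 + 12 u b) - 8 b^2], which is the characteristic polynomial
    of the generator [g] scaled by [2 v^2]. *)
Definition cubic_factor (e u M b : int) : {poly int} := Poly
  [:: 24 * u * M ^+ 4 * b - M ^+ 6 - 64 * M ^+ 3 * b ^+ 2 + 512 * b ^+ 4;
      e * (224 * M ^+ 2 * b ^+ 2 - 2 * M ^+ 5 - 1536 * u * b ^+ 3);
      10 * M ^+ 4 - 240 * u * M ^+ 2 * b + 64 * M * b ^+ 2 + 1152 * u ^+ 2 * b ^+ 2;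
      e * (16 * M ^+ 3 - 96 * u * M * b - 128 * b ^+ 2);
      192 * u * b - 20 * M ^+ 2; - (e * (8 * M)); 8].

(** The cubic is [x^3 + D x + Q], that is [v^3 c(x/v)], evaluated at [X / nu];
    the first factor on the right is the norm of [s^2 - g^2]. *)
Lemma cubic_splitting (u M b S D Q a : int) :
    D = M - 3 * u ^+ 2 -> Q = b - u * M + 2 * u ^+ 3 -> a = M ^+ 2 - 8 * u * b ->
  let T := S ^+ 2 - a in
  let X := 4 * T ^+ 3 - 3 * a ^+ 2 * T - 256 * Q * b ^+ 3 in
  let nu := 4 * b * M * (3 * M ^+ 3 - 48 * u * b * M + 64 * b ^+ 2) in
  X ^+ 3 + D * nu ^+ 2 * X + Q * nu ^+ 3 =
  (T ^+ 3 + 16 * D * b ^+ 2 * T - 64 * Q * b ^+ 3)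
    * (cubic_factor 1 u M b).[S] * (cubic_factor (-1) u M b).[S].
Proof. by move=> -> -> -> /=; rewrite !horner_Poly /=; ring. Qed.

(** The constant [mu] allows factorizations over the rationals. *)
Lemma linear_cubic_smooth (f : {poly int}) (mu a1 b1 al be ga de : int) :
    f != 0 -> mu != 0 -> al != 0 ->
    (forall n : int, mu * f.[n] =
       (a1 * n + b1) * (al * n ^+ 3 + be * n ^+ 2 + ga * n + de)) ->
  often_smooth f.
Proof.
move=> f0; wlog al0 : mu al be ga de / 0 < al => [IH mu0 al0 Hf|mu0 _ Hf].
  case: (ltP 0 al) => [h|h]; first exact: (IH mu al be ga de).
  apply: (IH (- mu) (- al) (- be) (- ga) (- de)); rewrite ?oppr_eq0 ?oppr_gt0 //.
    by rewrite lt_neqAle al0.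
  by move=> n; rewrite mulNr Hf; ring.
pose P := 3 * al * ga - be ^+ 2.
pose q := 27 * al ^+ 2 * de - 9 * al * be * ga + 2 * be ^+ 3.
have al1 : 27 * al ^+ 2 != 0 by rewrite mulf_neq0 // expf_neq0 // gt_eqF.
have tschirnhaus (n : int) : 27 * al ^+ 2 * (al * n ^+ 3 + be * n ^+ 2 + ga * n + de) =
    (3 * al * n + be) ^+ 3 + 3 * P * (3 * al * n + be) + q by rewrite /P /q; ring.
(* With a double root [r] the cubic is, up to a constant, [(x - r)^2 (x + 2r)], and
   [f] is a product of linear factors. *)
case: (eqVneq (q ^+ 2 + 4 * P ^+ 3) 0) => [disc0|disc].
  have [r [Pr qr]] : exists r, P = - r ^+ 2 /\ q = 2 * r ^+ 3.
    case: (eqVneq P 0) => [P0|P0].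
      exists 0; move: disc0; rewrite P0 expr0n mulr0 addr0 => /eqP; rewrite sqrf_eq0 => /eqP ->.
      by rewrite !expr0n !(oppr0, mulr0).
    have /dvdzP[t qt] : (2 * P %| q)%Z.
      apply: dvdz_sqr; apply/dvdzP; exists (- P).
      have -> : q ^+ 2 = - (4 * P ^+ 3) by apply/eqP; rewrite -subr_eq0 opprK disc0.
      by ring.
    exists (- t).
    have : 4 * P ^+ 2 * (t ^+ 2 + P) == 0 by rewrite -disc0 qt; apply/eqP; ring.
    rewrite mulf_eq0 mulf_eq0 sqrf_eq0 (negPf P0) orbF /= => /eqP h.
    have -> : q = 2 * t * (t ^+ 2 + P) - 2 * t ^+ 3 by rewrite qt; ring.
    have -> : P = (t ^+ 2 + P) - t ^+ 2 by ring.
    by rewrite h; split; ring.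
  pose lin (c e : int) := c *: 'X + e%:P : {poly int}.
  have slin c e : (size (lin c e) <= 2)%N.
    rewrite (leq_trans (size_polyD _ _)) // geq_max (leq_trans (size_scale_leq _ _)) ?size_polyX //.
    by rewrite (leq_trans (size_polyC_leq1 _)).
  apply: (@smooth_values f 'X 1 (27 * al ^+ 2 * mu) 1 0
    [:: lin a1 b1; lin (3 * al) (be - r); lin (3 * al) (be - r); lin (3 * al) (be + 2 * r)]) => //.
  - by rewrite mulf_neq0.
  - by rewrite size_polyX.
  - by rewrite coefX mul1r.
  - by move=> U; rewrite !inE => /or4P[] /eqP ->.
  - move=> s n; rewrite hornerX mul1r => ->.
    have -> : 27 * al ^+ 2 * mu * f.[n] = 27 * al ^+ 2 * (mu * f.[n]) by ring.
    rewrite Hf mulrCA tschirnhaus Pr qr !big_cons big_nil.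
    by rewrite /lin !(hornerD, hornerZ, hornerX, hornerC); ring.
have B0 : 0 < 36 * al * `|q ^+ 2 + 4 * P ^+ 3| by rewrite !mulr_gt0 // normr_gt0.
have [u [v [j [[u0 v0 Bv uv] [Ej hP hq]]]]] := cubic_parameters P q _ B0.
pose m := u ^+ 2 + P * v ^+ 2; pose b := u ^+ 3 + 3 * P * v ^+ 2 * u + q * v ^+ 3.
pose H := 81 * m ^+ 3 - 144 * u * b * m + 64 * b ^+ 2.
pose a := 9 * m ^+ 2 - 8 * u * b.
have [m0 b0 H0] : [/\ 0 < m, 0 < b & 0 < H].
  have [] := cubic_params_pos u (P * v ^+ 2) (q * v ^+ 3) u0 hP hq.
  by rewrite mulrA.
have v36 : (36 * al %| v)%Z by apply: dvdz_trans Bv; exact: dvdz_mulr.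
pose p : {poly int} := Poly [:: - a ^+ 3 - 256 * (q * v ^+ 3) * b ^+ 3 - 12 * v * b * m * H * be;
  0; 9 * a ^+ 2; 0; - (12 * a); 0; 4].
have Ep s : p.[s] = 4 * (s ^+ 2 - a) ^+ 3 - 3 * a ^+ 2 * (s ^+ 2 - a)
    - 256 * (q * v ^+ 3) * b ^+ 3 - 12 * v * b * m * H * be.
  by rewrite horner_Poly /=; ring.
have [||s0 Hs0] := @cubic_root u v P q j be m b H a p erefl erefl erefl erefl uv _ _ Ej Ep.
- by apply: dvdz_trans v36; rewrite dvdz_mulr.
- by apply: dvdz_trans Bv; rewrite dvdz_mull // dvdzE absz_id.
pose d := 12 * v * b * m * H * (3 * al).
pose nu := 12 * b * m * H.
(* The norm of [s^2 - g^2], expanded. *)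
pose U1 : {poly int} := Poly
  [:: - a ^+ 3 - 48 * P * v ^+ 2 * b ^+ 2 * a - 64 * (q * v ^+ 3) * b ^+ 3;
  0; 3 * a ^+ 2 + 48 * P * v ^+ 2 * b ^+ 2; 0; - (3 * a); 0; 1].
have sp : (size p <= 7)%N by exact: size_Poly.
have d0 : 0 < d by rewrite !mulr_gt0.
have nuv0 : 0 < nu * v by rewrite !mulr_gt0.
apply: (@smooth_values f p 6 (27 * al ^+ 2 * (nu * v) ^+ 3 * d * mu) d s0
  [:: a1 *: p + (d * b1)%:P; U1; cubic_factor 1 u (3 * m) b; cubic_factor (-1) u (3 * m) b]) => //.
- apply: mulf_neq0 mu0; apply: mulf_neq0 (lt0r_neq0 d0).
  by apply: mulf_neq0 al1 _; rewrite expf_neq0 // lt0r_neq0.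
- by rewrite /p coef_Poly mulr_gt0.
- apply: dvdz_trans Hs0.
  have -> : d = 36 * al * (v * (b * (m * H))) by rewrite /d; ring.
  by rewrite expr2 -mulrA dvdz_mul.
- move=> U; rewrite !inE => /or4P[] /eqP ->; rewrite ?size_Poly //.
  rewrite (leq_trans (size_polyD _ _)) // geq_max (leq_trans (size_scale_leq _ _)) //.
  by rewrite (leq_trans (size_polyC_leq1 _)).
move=> s n pn.
rewrite !big_cons big_nil mulr1 hornerD hornerZ hornerC pn.
have -> : 27 * al ^+ 2 * (nu * v) ^+ 3 * d * mu * f.[n] =
   d * (a1 * n + b1) * ((nu * v) ^+ 3 * (27 * al ^+ 2 * (al * n ^+ 3 + be * n ^+ 2 + ga * n + de))).
  have -> : 27 * al ^+ 2 * (nu * v) ^+ 3 * d * mu * f.[n] =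
    27 * al ^+ 2 * (nu * v) ^+ 3 * d * (mu * f.[n]) by ring.
  by rewrite Hf; ring.
rewrite tschirnhaus.
have -> : a1 * (d * n) + d * b1 = d * (a1 * n + b1) by ring.
congr (_ * _); rewrite mulrA.
have -> : U1.[s] = (s ^+ 2 - a) ^+ 3 + 16 * (3 * P * v ^+ 2) * b ^+ 2 * (s ^+ 2 - a)
    - 64 * (q * v ^+ 3) * b ^+ 3 by rewrite horner_Poly /=; ring.
rewrite -cubic_splitting; first last.
- by rewrite /a; ring.
- by rewrite /b /m; ring.
- by rewrite /m; ring.
have -> : 4 * (s ^+ 2 - a) ^+ 3 - 3 * a ^+ 2 * (s ^+ 2 - a) - 256 * (q * v ^+ 3) * b ^+ 3
    = nu * v * (3 * al * n + be).
  have -> : nu * v * (3 * al * n + be) = d * n + 12 * v * b * m * H * be by rewrite /nu /d; ring.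
  by rewrite -pn Ep; ring.
have -> : 4 * b * (3 * m) * (3 * (3 * m) ^+ 3 - 48 * u * b * (3 * m) + 64 * b ^+ 2) = nu.
  by rewrite /nu /H; ring.
by ring.
Qed.

(** * Two quadratic factors *)

(** The values of the parameters are [De = D1 w^2 - 1], [M = 1 - D2 w^2] and
    [N = M - 4 E w], and [X = 128 N w x].  In terms of the scaled variable [w x],
    the conic parameter is [A = N / De], and [Phi / (8 N)] is [(Y - 1) / De]; the
    variable [e] is affine in [s].  The last two factors are norms from
    [Q(sqrt D2)] of quadratics in [e], since [1 - M = (w sqrt D2)^2]. *)
Lemma quadratics_splitting (N De M e T Phi X : int) :
    T = N + De -> Phi = 4 * M - 16 + (4 * M * De - 8 * T) * e + T * M * De * e ^+ 2 ->
    128 * N + 16 * T * Phi + De * Phi ^+ 2 - 64 * N ^+ 2 = X ->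
  X ^+ 2 - (128 * N) ^+ 2 * (1 + De) =
    (De * Phi ^+ 2 + 16 * N * Phi - 64 * N ^+ 2) *
    (De * Phi ^+ 2 + (16 * N + 32 * De) * Phi - 64 * N ^+ 2 + 256 * T) /\
  M * ((X - 64 * N * (M - N)) ^+ 2 - (128 * N) ^+ 2 * (1 - M)) =
    ((De * T * e ^+ 2 - 4 * N * e - 4) ^+ 2
      - (1 - M) * (De * T * e ^+ 2 + 4 * De * e + 4) ^+ 2) *
    ((T * M ^+ 2 * De ^+ 2 * e ^+ 2 + (4 * De ^+ 2 * M ^+ 2 - 12 * T * M * De) * e
       + 4 * De * M ^+ 2 - 24 * De * M + 32 * T) ^+ 2
      - (1 - M) * (4 * T * M * De * e + 8 * De * M - 32 * T) ^+ 2).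
Proof. by move=> -> -> <-; split; ring. Qed.

(** Modulo [N] a root is given by [De * e = -2], which makes [Phi] vanish.  For the
    primes fixed in advance, which divide [w], the expansion of [p] at
    [e = -5 + w * ep] starts with [64 * w * (ep - 2 * be + 7 * E)].  The number
    [16 E^2 D1 - (D1 - D2)^2] is, up to sign, the resultant of [De] and [N] as
    polynomials in [w]; since it divides [w], which is coprime to [De], these two
    are coprime. *)
Lemma quadratics_root (D1 D2 E be ka w De N M T : int) (p : {poly int}) :
    De = D1 * w ^+ 2 - 1 -> M = 1 - D2 * w ^+ 2 ->
    N = 1 - D2 * w ^+ 2 - 4 * E * w -> T = N + De ->
    (128 * ka %| w)%Z -> (16 * E ^+ 2 * D1 - (D1 - D2) ^+ 2 %| w)%Z ->
    (forall e, let Phi := 4 * M - 16 + (4 * M * De - 8 * T) * e + T * M * De * e ^+ 2 in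
      p.[e] = 128 * N + 16 * T * Phi + De * Phi ^+ 2 - 64 * N ^+ 2 - 128 * N * w * be) ->
  exists e, (N * (128 * w * ka) %| p.[e])%Z.
Proof.
move=> EDe EM EN ET wk wR Ep.
have Dew : coprimez De w.
  have -> : De = - 1 + (D1 * w) * w by rewrite EDe; ring.
  by rewrite coprimez_modl coprimezE coprime1n.
have Nw : coprimez N w.
  have -> : N = 1 + (- (D2 * w) - 4 * E) * w by rewrite EN; ring.
  by rewrite coprimez_modl coprimezE coprime1n.
have DeN : coprimez De N.
  set L := (D1 - D2) * w - 4 * E.
  have ELT : N = w * L + (- 1) * De by rewrite EN EDe /L; ring.
  rewrite coprimez_sym ELT coprimez_modl coprimezMl coprimez_sym Dew /=.
  suff : coprimez (D1 * (L + 8 * E) * L) De by rewrite coprimezMl => /andP[].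
  have -> : D1 * (L + 8 * E) * L =
      - (16 * E ^+ 2 * D1 - (D1 - D2) ^+ 2) + (D1 - D2) ^+ 2 * De.
    by rewrite /L EDe; ring.
  by rewrite coprimez_modl coprimeNz (coprimez_dvd wR) // coprimez_sym.
(* Replacing [128 w ka] by its multiple [w ^+ 2] makes the expansion in [w] apply. *)
suff [e he] : exists e, (N * w ^+ 2 %| p.[e])%Z.
  exists e; apply: dvdz_trans he; rewrite dvdz_mul //.
  by rewrite mulrAC expr2 dvdz_mul.
apply: root_mod_mul; first by rewrite coprimezXr.
  have /coprimezP[[x y] /= xy] := DeN.
  have [k ek] : exists k, De * (- 2 * x) = - 2 + N * k.
    exists (2 * y); rewrite -[X in X + _](mulr1 (- 2)) -{2}xy; ring.
  exists (- 2 * x); rewrite Ep; set e := - 2 * x in ek *.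
  have -> : 4 * M - 16 + (4 * M * De - 8 * T) * e + T * M * De * e ^+ 2 =
     - 16 + 4 * M * (1 + De * e) + (N * e + De * e) * (M * (De * e) - 8) by rewrite ET; ring.
  rewrite ek.
  have -> : - 16 + 4 * M * (1 + (-2 + N * k)) + (N * e + (-2 + N * k)) * (M * (-2 + N * k) - 8)
      = N * (4 * M * k + (e + k) * (M * (-2 + N * k) - 8) - 2 * M * k) by ring.
  set f := _ - 2 * M * k.
  apply/dvdzP; exists (128 + 16 * T * f + De * N * f ^+ 2 - 64 * N - 128 * w * be); ring.
exists (- 5 + w * (2 * be - 7 * E)); rewrite Ep.
set ep := 2 * be - 7 * E; set z := 4 * ep + 60 * E.
pose m' := D1 + D2 - D1 * D2 * w ^+ 2.
have eMDe : M * De = - 1 + w ^+ 2 * m' by rewrite EM EDe /m'; ring.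
have eT : T = - (4 * E * w) + w ^+ 2 * (D1 - D2) by rewrite ET EN EDe; ring.
have [ph ePhi] : exists ph,
    4 * M - 16 + (4 * M * De - 8 * T) * (- 5 + w * ep) + T * M * De * (- 5 + w * ep) ^+ 2
      = 8 - w * z + w ^+ 2 * ph.
  exists (- 4 * D2 + 4 * m' * (- 5 + w * ep)
    - (D1 - D2) * (- 5 + w * ep) * (3 + w * ep)
    + T * m' * (- 5 + w * ep) ^+ 2 + 4 * E * (- 2 * ep + w * ep ^+ 2)).
  have -> : 4 * M - 16 + (4 * M * De - 8 * T) * (- 5 + w * ep) + T * M * De * (- 5 + w * ep) ^+ 2
    = 4 * M - 16 + 4 * (M * De) * (- 5 + w * ep)
      + T * (- 5 + w * ep) * ((M * De) * (- 5 + w * ep) - 8) by ring.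
  by rewrite eMDe eT EM /z; ring.
rewrite ePhi; set Phi := 8 - w * z + w ^+ 2 * ph.
apply/dvdzP.
exists (- 128 * D2 + 16 * (D1 - D2) * Phi - 64 * E * (- z + w * ph) + D1 * Phi ^+ 2
  - (- z + w * ph) ^+ 2 - 16 * ph - 64 * ((- 4 * E - w * D2) ^+ 2 - 2 * D2)
  - 128 * be * (- 4 * E - w * D2)).
by rewrite eT EN EDe /Phi /z /ep; ring.
Qed.

(** The leading coefficients of [p] and of the denominator have the signs of [D1]
    and of [- D2 w ka]; hence the choice of the sign of [w]. *)
Lemma quadratics_sign (D1 D2 E ka K : int) : D1 != 0 -> D2 != 0 -> ka != 0 ->
    4 * `|E| + 2 <= K ->
  let w := - (D1 * D2 * ka * K) in
  [/\ 4 * `|E| + 2 <= `|w|,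
      0 < (D1 * w ^+ 2 - 1) * ((1 - D2 * w ^+ 2 - 4 * E * w) * (w * ka)) &
      1 - D2 * w ^+ 2 != 0].
Proof.
move=> D10 D20 ka0 KE w.
have K0 : 0 < K by lia.
have wE : 4 * `|E| + 2 <= `|w|.
  apply: (le_trans KE); rewrite normrN normrM (gtr0_norm K0) ler_peMl ?(ltW K0) //.
  by rewrite -gtz0_ge1 normr_gt0 !mulf_neq0.
have w2 : w ^+ 2 = `|w| * `|w| by rewrite -expr2 real_normK // num_real.
have w1 : 2 <= `|w| by apply: le_trans wE; lia.
have ww : 4 * `|E| * `|w| + 2 * `|w| <= w ^+ 2 by rewrite -mulrDl w2 ler_wpM2r.
have big (D : int) : D != 0 -> 0 < D * (D * w ^+ 2 - 1).
  move=> D0; have -> : D * (D * w ^+ 2 - 1) = D ^+ 2 * w ^+ 2 - D by ring.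
  have D1' : `|D| <= D ^+ 2.
    by rewrite -[D ^+ 2]real_normK ?num_real // expr2 ler_peMr // -gtz0_ge1 normr_gt0.
  have h : `|D| * 2 <= D ^+ 2 * w ^+ 2.
    apply: ler_pM => //; apply: (le_trans w1).
    by rewrite w2 ler_peMr //; apply: (le_trans _ w1).
  have : 0 < `|D| by rewrite normr_gt0.
  by move: h; move: (_ * w ^+ 2) => y; lia.
split=> //.
- have N0 : 0 < - D2 * (1 - D2 * w ^+ 2 - 4 * E * w).
    have -> : - D2 * (1 - D2 * w ^+ 2 - 4 * E * w) =
      D2 ^+ 2 * w ^+ 2 + D2 * (4 * E * w) - D2 by ring.
    have D2' : `|D2| <= D2 ^+ 2.
      by rewrite -[D2 ^+ 2]real_normK ?num_real // expr2 ler_peMr // -gtz0_ge1 normr_gt0.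
    have h : `|D2| * (4 * `|E| * `|w| + 2 * `|w|) <= D2 ^+ 2 * w ^+ 2.
      by apply: ler_pM => //; rewrite addr_ge0 ?mulr_ge0.
    have h2 : - (`|D2| * (4 * `|E| * `|w|)) <= D2 * (4 * E * w).
      have -> : `|D2| * (4 * `|E| * `|w|) = `|D2 * (4 * E * w)| by rewrite !normrM.
      by rewrite lerNl ler_normr lexx orbT.
    have h3 : `|D2| * 4 <= `|D2| * (2 * `|w|) by rewrite ler_wpM2l //; lia.
    have h4 : 0 < `|D2| by rewrite normr_gt0.
    move: h h2 h3 h4; rewrite mulrDr; clear.
    by move: (D2 ^+ 2 * w ^+ 2) (D2 * (4 * E * w)) (_ * (4 * _ * _)) (_ * (2 * _)) => x y z t; lia.
  have W0 : 0 < - (D1 * D2 * ka) * w.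
    have h : D1 * D2 * ka != 0 by rewrite !mulf_neq0.
    have -> : - (D1 * D2 * ka) * w = (D1 * D2 * ka) ^+ 2 * K by rewrite /w; ring.
    by rewrite mulr_gt0 // exprn_even_gt0.
  have D0 := big D1 D10.
  have sq : 0 < (D1 * D2) ^+ 2 by rewrite exprn_even_gt0 //= mulf_neq0.
  rewrite -(pmulr_rgt0 _ sq).
  have -> : (D1 * D2) ^+ 2 * ((D1 * w ^+ 2 - 1) * ((1 - D2 * w ^+ 2 - 4 * E * w) * (w * ka)))
    = (D1 * (D1 * w ^+ 2 - 1)) * (- D2 * (1 - D2 * w ^+ 2 - 4 * E * w))
      * (- (D1 * D2 * ka) * w) by ring.
  by apply: mulr_gt0 W0; apply: mulr_gt0 N0.
- by apply: contraTneq (big D2 D20) => h; rewrite -opprB h oppr0 mulr0 ltxx.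
Qed.

(** In the variable [x = 4 a1 a2 n + 2 a2 b1] the quadratic factors become
    [x^2 - D1] and [(x - 2 E)^2 - D2]. *)
Lemma generic_quadratics_smooth (f : {poly int}) (mu a1 b1 c1 a2 b2 c2 : int) :
    let D1 := 4 * a2 ^+ 2 * (b1 ^+ 2 - 4 * a1 * c1) in
    let D2 := 4 * a1 ^+ 2 * (b2 ^+ 2 - 4 * a2 * c2) in
    let E := a2 * b1 - a1 * b2 in
    f != 0 -> mu != 0 -> a1 != 0 -> a2 != 0 -> D1 != 0 -> D2 != 0 ->
    16 * E ^+ 2 * D1 - (D1 - D2) ^+ 2 != 0 ->
    (forall n : int, mu * f.[n] =
       (a1 * n ^+ 2 + b1 * n + c1) * (a2 * n ^+ 2 + b2 * n + c2)) ->
  often_smooth f.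
Proof.
move=> D1 D2 E f0 mu0 a10 a20 D10 D20 R0 Hf.
set R := _ - _ in R0.
pose ka := 4 * a1 * a2; pose be := 2 * a2 * b1.
have ka0 : ka != 0 by rewrite !mulf_neq0.
pose K := 128 * R ^+ 2 * (4 * `|E| + 2).
have KE : 4 * `|E| + 2 <= K.
  have r2 : 0 < R ^+ 2 by rewrite exprn_even_gt0 //= R0.
  apply: ler_peMl; first by rewrite addr_ge0 ?mulr_ge0.
  by move: r2; move: (R ^+ 2) => r; clear; lia.
have [] := quadratics_sign D1 D2 E ka K D10 D20 ka0 KE.
set w := - _.
have wk : (128 * ka %| w)%Z.
  by apply/dvdzP; exists (- (D1 * D2 * R ^+ 2 * (4 * `|E| + 2))); rewrite /w /K; ring.
have wR : (R %| w)%Z.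
  by apply/dvdzP; exists (- (D1 * D2 * ka * 128 * R * (4 * `|E| + 2))); rewrite /w /K; ring.
clearbody w => wE.
have w0 : w != 0 by rewrite -normr_gt0 (lt_le_trans _ wE) // ltr_wpDl ?mulr_ge0.
set De := _ - 1; set N := _ - 4 * E * w; set M := 1 - _ => sgn M0.
pose T := N + De.
have T0 : T != 0.
  have -> : T = w * ((D1 - D2) * w - 4 * E) by rewrite /T /N /De; ring.
  apply: (mulf_neq0 w0); apply/negP => /eqP h.
  have {h} h : (D1 - D2) * w = 4 * E by apply/eqP; rewrite -subr_eq0 h.
  case: (eqVneq (D1 - D2) 0) => [h0|h0].
    move: h R0; rewrite /R h0 mul0r => /esym/eqP; rewrite mulf_eq0 /= => /eqP ->.
    by rewrite !expr0n mulr0 mul0r subr0 eqxx.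
  have : `|w| <= `|(D1 - D2) * w|.
    by rewrite normrM ler_peMl // -gtz0_ge1 normr_gt0.
  by rewrite h normrM; move: wE; clear; lia.
have De0 : De != 0 by apply: contraTneq sgn => ->; rewrite mul0r ltxx.
have N0 : N != 0 by apply: contraTneq sgn => ->; rewrite mul0r mulr0 ltxx.
(* The coefficients of [Phi]. *)
pose x0 := 4 * M - 16; pose x1 := 4 * M * De - 8 * T; pose x2 := T * M * De.
pose p : {poly int} := Poly
  [:: De * x0 ^+ 2 + 16 * T * x0 + 128 * N - 64 * N ^+ 2 - 128 * N * w * be;
  2 * De * x0 * x1 + 16 * T * x1; De * (x1 ^+ 2 + 2 * x0 * x2) + 16 * T * x2;
  2 * De * x1 * x2; De * x2 ^+ 2].
have Ep e : let Phi := 4 * M - 16 + (4 * M * De - 8 * T) * e + T * M * De * e ^+ 2 in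
   p.[e] = 128 * N + 16 * T * Phi + De * Phi ^+ 2 - 64 * N ^+ 2 - 128 * N * w * be.
  by rewrite /= horner_Poly /= /x0 /x1 /x2; ring.
have [s0 Hs0] := @quadratics_root D1 D2 E be ka w De N M T p erefl erefl erefl erefl wk wR Ep.
pose Phi : {poly int} := Poly [:: x0; x1; x2].
pose A1 : {poly int} := Poly [:: - 4; - (4 * N); De * T].
pose B1 : {poly int} := Poly [:: 4; 4 * De; De * T].
pose A2 : {poly int} := Poly [:: 4 * De * M ^+ 2 - 24 * De * M + 32 * T;
   4 * De ^+ 2 * M ^+ 2 - 12 * T * M * De; T * M ^+ 2 * De ^+ 2].
pose B2 : {poly int} := Poly [:: 8 * De * M - 32 * T; 4 * T * M * De].
have szD n (U V : {poly int}) : (size U <= n)%N -> (size V <= n)%N -> (size (U + V)%R <= n)%N.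
  by move=> sU sV; rewrite (leq_trans (size_polyD _ _)) // geq_max sU.
have szZ n c (U : {poly int}) : (size U <= n)%N -> (size (c *: U)%R <= n)%N.
  exact: leq_trans (size_scale_leq _ _).
have szX (U : {poly int}) : (size U <= 3)%N -> (size (U ^+ 2)%R <= 5)%N.
  move=> sU; rewrite (leq_trans (size_poly_exp_leq _ _)) //.
  by case: (size U) sU => [|[|[|[|]]]].
have sPhi : (size Phi <= 3)%N by exact: size_Poly.
have sz1 a b c : (size (a *: Phi ^+ 2 + b *: Phi + c%:P)%R <= 5)%N.
  apply: (szD); last by rewrite (leq_trans (size_polyC_leq1 _)).
  by apply: (szD); apply: (szZ); [exact: szX | exact: leq_trans sPhi _].
have sz2 (U V : {poly int}) c : (size U <= 3)%N -> (size V <= 3)%N ->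
    (size (U ^+ 2 - c *: V ^+ 2)%R <= 5)%N.
  by move=> sU sV; apply: (szD); rewrite ?size_polyN ?szZ ?szX.
apply: (@smooth_values f p 4 ((128 * N * w) ^+ 4 * 256 * a1 ^+ 3 * a2 ^+ 3 * M * mu)
  (N * (128 * w * ka)) s0
  [:: De *: Phi ^+ 2 + (16 * N) *: Phi + (- (64 * N ^+ 2))%:P;
      De *: Phi ^+ 2 + (16 * N + 32 * De) *: Phi + (256 * T - 64 * N ^+ 2)%:P;
      A1 ^+ 2 - (1 - M) *: B1 ^+ 2; A2 ^+ 2 - (1 - M) *: B2 ^+ 2]) => //.
- apply: mulf_neq0 mu0; apply: mulf_neq0 M0.
  have n4 : (128 * N * w) ^+ 4 != 0 by rewrite expf_neq0 // !mulf_neq0.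
  have [p1 p2] : a1 ^+ 3 != 0 /\ a2 ^+ 3 != 0 by rewrite !expf_neq0.
  by apply: mulf_neq0 p2; apply: mulf_neq0 p1; apply: mulf_neq0 n4 _.
- exact: size_Poly.
- rewrite /p coef_Poly /=.
  have -> : N * (128 * w * ka) * (De * x2 ^+ 2) = (De * (N * (w * ka))) * (128 * x2 ^+ 2) by ring.
  apply: mulr_gt0 sgn _; apply: mulr_gt0 => //.
  by rewrite exprn_even_gt0 //= mulf_neq0 // mulf_neq0.
- move=> U; rewrite !inE => /or4P[] /eqP ->; rewrite ?sz1 ?sz2 ?size_Poly //.
  by rewrite (leq_trans (size_Poly _)).
move=> s n pn.
have hx : 128 * N + 16 * T * Phi.[s] + De * Phi.[s] ^+ 2 - 64 * N ^+ 2 =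
    128 * N * w * (ka * n + be).
  have -> : 128 * N * w * (ka * n + be) = N * (128 * w * ka) * n + 128 * N * w * be by ring.
  by rewrite -pn Ep horner_Poly /= /x0 /x1 /x2; ring.
have ePhi : Phi.[s] = 4 * M - 16 + (4 * M * De - 8 * T) * s + T * M * De * s ^+ 2.
  by rewrite horner_Poly /= /x0 /x1 /x2; ring.
have [h1 h2] := @quadratics_splitting N De M s T _ _ erefl ePhi hx.
have -> : (128 * N * w) ^+ 4 * 256 * a1 ^+ 3 * a2 ^+ 3 * M * mu * f.[n] =
   ((128 * N * w) ^+ 2 * (16 * a1 * a2 ^+ 2 * (a1 * n ^+ 2 + b1 * n + c1))) *
   (M * ((128 * N * w) ^+ 2 * (16 * a1 ^+ 2 * a2 * (a2 * n ^+ 2 + b2 * n + c2)))).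
  have -> : (128 * N * w) ^+ 4 * 256 * a1 ^+ 3 * a2 ^+ 3 * M * mu * f.[n] =
    (128 * N * w) ^+ 4 * 256 * a1 ^+ 3 * a2 ^+ 3 * M * (mu * f.[n]) by ring.
  by rewrite Hf; ring.
have -> : (128 * N * w) ^+ 2 * (16 * a1 * a2 ^+ 2 * (a1 * n ^+ 2 + b1 * n + c1)) =
    (128 * N * w * (ka * n + be)) ^+ 2 - (128 * N) ^+ 2 * (1 + De).
  by rewrite /De /ka /be /D1; ring.
have -> : (128 * N * w) ^+ 2 * (16 * a1 ^+ 2 * a2 * (a2 * n ^+ 2 + b2 * n + c2)) =
    (128 * N * w * (ka * n + be) - 64 * N * (M - N)) ^+ 2 - (128 * N) ^+ 2 * (1 - M).
  have -> : M - N = 4 * E * w by rewrite /M /N; ring.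
  by rewrite /M /ka /be /D2 /E; ring.
rewrite (congr2 *%R h1 h2) !big_cons big_nil mulr1 -[LHS]mulrA.
congr (_ * (_ * (_ * _))).
- by rewrite !(hornerD, hornerZ, hornerC, horner_exp).
- by rewrite !(hornerD, hornerZ, hornerC, horner_exp) addrA addrAC.
- by rewrite !(hornerD, hornerN, hornerZ, horner_exp) !horner_Poly /=; ring.
- by rewrite !(hornerD, hornerN, hornerZ, horner_exp) !horner_Poly /=; ring.
Qed.

(** With [Q = a n^2 + b n + c], the polynomial [Q(s)] divides [Q(s + a Q(s))], and
    the factor [a] makes the leading coefficient of [s + a Q(s)] positive. *)
Lemma proportional_quadratics_smooth (f : {poly int}) (mu nu a b c : int) :
    f != 0 -> mu != 0 -> a != 0 ->
    (forall n : int, mu * f.[n] = nu * (a * n ^+ 2 + b * n + c) ^+ 2) ->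
  often_smooth f.
Proof.
move=> f0 mu0 a0 Hf.
apply: (@smooth_values f (Poly [:: a * c; a * b + 1; a ^+ 2]) 2 mu 1 0
  [:: nu%:P; Poly [:: c; b; a]; Poly [:: c; b; a];
      Poly [:: 1 + a * b + a ^+ 3 * c; 2 * a ^+ 2 + a ^+ 3 * b; a ^+ 4];
      Poly [:: 1 + a * b + a ^+ 3 * c; 2 * a ^+ 2 + a ^+ 3 * b; a ^+ 4]]) => //.
- exact: size_Poly.
- by rewrite coef_Poly /= mul1r exprn_even_gt0 //= a0.
- move=> U; rewrite !inE => /or4P[/eqP->|/eqP->|/eqP->|/orP[]/eqP->]; rewrite ?size_Poly //.
  by rewrite (leq_trans (size_polyC_leq1 _)).
- move=> s n; rewrite mul1r Hf => <-.
  by rewrite !big_cons big_nil hornerC !horner_Poly /=; ring.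
Qed.

Lemma reducible_quadratic_smooth (f : {poly int}) (mu a1 b1 c1 a2 b2 c2 s : int) :
    f != 0 -> mu != 0 -> a1 != 0 -> a2 != 0 -> b1 ^+ 2 - 4 * a1 * c1 = s ^+ 2 ->
    (forall n : int, mu * f.[n] =
       (a1 * n ^+ 2 + b1 * n + c1) * (a2 * n ^+ 2 + b2 * n + c2)) ->
  often_smooth f.
Proof.
move=> f0 mu0 a10 a20 ds Hf.
apply: (@linear_cubic_smooth f (4 * a1 * mu) (2 * a1) (b1 - s) (2 * a1 * a2)
   (2 * a1 * b2 + (b1 + s) * a2) (2 * a1 * c2 + (b1 + s) * b2) ((b1 + s) * c2)) => //.
- by rewrite !mulf_neq0.
- by rewrite !mulf_neq0.
- move=> n; rewrite -mulrA Hf.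
  have -> : (2 * a1 * n + (b1 - s)) * (2 * a1 * a2 * n ^+ 3 + (2 * a1 * b2 + (b1 + s) * a2) * n ^+ 2
     + (2 * a1 * c2 + (b1 + s) * b2) * n + (b1 + s) * c2) =
    ((2 * a1 * n + b1) ^+ 2 - s ^+ 2) * (a2 * n ^+ 2 + b2 * n + c2) by ring.
  by rewrite -ds; ring.
Qed.

(** If the number [16 E^2 D1 - (D1 - D2)^2] vanishes, then either [E = 0] and the
    quadratics are proportional, or [D1] is a square. *)
Lemma quadratics_smooth (f : {poly int}) (a1 b1 c1 a2 b2 c2 : int) :
    f != 0 -> a1 != 0 -> a2 != 0 ->
    (forall n : int, f.[n] =
       (a1 * n ^+ 2 + b1 * n + c1) * (a2 * n ^+ 2 + b2 * n + c2)) ->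
  often_smooth f.
Proof.
move=> f0 a10 a20 Hf.
have Hf1 n : 1 * f.[n] = (a1 * n ^+ 2 + b1 * n + c1) * (a2 * n ^+ 2 + b2 * n + c2).
  by rewrite mul1r.
have Hf2 n : 1 * f.[n] = (a2 * n ^+ 2 + b2 * n + c2) * (a1 * n ^+ 2 + b1 * n + c1).
  by rewrite mul1r Hf mulrC.
set d1 := b1 ^+ 2 - 4 * a1 * c1; set d2 := b2 ^+ 2 - 4 * a2 * c2.
case: (eqVneq d1 0) => [d10|d10].
  by apply: (reducible_quadratic_smooth f 1 _ _ _ _ _ _ 0 f0 _ a10 a20 _ Hf1); rewrite // expr0n.
case: (eqVneq d2 0) => [d20|d20].
  by apply: (reducible_quadratic_smooth f 1 _ _ _ _ _ _ 0 f0 _ a20 a10 _ Hf2); rewrite // expr0n.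
pose D1 := 4 * a2 ^+ 2 * d1; pose D2 := 4 * a1 ^+ 2 * d2; pose E := a2 * b1 - a1 * b2.
case: (eqVneq (16 * E ^+ 2 * D1 - (D1 - D2) ^+ 2) 0) => [R0|R0]; last first.
  by apply: (generic_quadratics_smooth f 1 a1 b1 c1 a2 b2 c2) => //; rewrite !mulf_neq0 ?expf_neq0.
case: (eqVneq E 0) => [E0|E0].
  have e1 : a2 * b1 = a1 * b2 by apply/eqP; rewrite -subr_eq0 -/E E0.
  have e2 : a2 * c1 = a1 * c2.
    move: R0; rewrite E0 expr0n mulr0 mul0r sub0r => /eqP; rewrite oppr_eq0 sqrf_eq0.
    have -> : D1 - D2 = 4 * ((a2 * b1) ^+ 2 - (a1 * b2) ^+ 2 - 4 * a1 * a2 * (a2 * c1 - a1 * c2)).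
      by rewrite /D1 /D2 /d1 /d2; ring.
    rewrite e1 subrr sub0r mulf_eq0 oppr_eq0 !mulf_eq0 /= (negPf a10) (negPf a20) subr_eq0.
    by move=> /eqP.
  apply: (proportional_quadratics_smooth f a1 a2 a1 b1 c1) => // n.
  have e3 : a1 * (a2 * n ^+ 2 + b2 * n + c2) = a2 * (a1 * n ^+ 2 + b1 * n + c1).
    have -> : a1 * (a2 * n ^+ 2 + b2 * n + c2) = a1 * a2 * n ^+ 2 + a1 * b2 * n + a1 * c2 by ring.
    by rewrite -e1 -e2; ring.
  by rewrite Hf mulrCA e3; ring.
have /dvdzP[t ht] : (4 * E %| D1 - D2)%Z.
  apply: dvdz_sqr; apply/dvdzP; exists D1.
  by apply/eqP; rewrite -subr_eq0 -[_ == 0]oppr_eq0 opprB -R0; apply/eqP; ring.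
have D1t : D1 = t ^+ 2.
  have : 16 * E ^+ 2 * (D1 - t ^+ 2) == 0 by rewrite -R0 ht; apply/eqP; ring.
  by rewrite mulf_eq0 mulf_eq0 sqrf_eq0 (negPf E0) /= subr_eq0 => /eqP.
have /dvdzP[s hs] : (2 * a2 %| t)%Z.
  by apply: dvdz_sqr; rewrite -D1t; apply/dvdzP; exists d1; rewrite /D1; ring.
apply: (reducible_quadratic_smooth f 1 a1 b1 c1 a2 b2 c2 s) => //; rewrite -/d1.
have : 4 * a2 ^+ 2 * (d1 - s ^+ 2) == 0.
  have -> : 4 * a2 ^+ 2 * (d1 - s ^+ 2) = D1 - t ^+ 2 by rewrite hs /D1; ring.
  by rewrite D1t subrr.
by rewrite mulf_eq0 mulf_eq0 sqrf_eq0 (negPf a20) /= subr_eq0 => /eqP.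
Qed.

(** * The theorem *)

Lemma linear_cubic_poly_smooth (g h : {poly int}) : g * h != 0 ->
  size g = 2%N -> size h = 4%N -> often_smooth (g * h).
Proof.
move=> gh sg sh.
apply: (@linear_cubic_smooth _ 1 g`_1 g`_0 h`_3 h`_2 h`_1 h`_0) => //.
  have : lead_coef h != 0 by rewrite lead_coef_eq0 -size_poly_eq0 sh.
  by rewrite lead_coefE sh.
move=> n; rewrite mul1r hornerM !horner_coef sg sh !big_ord_recl !big_ord0 /=.
by rewrite !expr0 !mulr1 /bump /=; ring.
Qed.

Theorem mainTheorem4 (f : {poly int}) (hf : reducible_quartic f) :
  forall N : nat, exists n : nat,
    [/\ (N < n)%N, f.[n%:Z] != 0 & (Pplus f.[n%:Z] < n)%N].
Proof.
case: hf => sf [g [h [sg sh fgh]]].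
have f0 : f != 0 by rewrite -size_poly_eq0 sf.
have [g0 h0] : g != 0 /\ h != 0 by apply/andP; rewrite -negb_or -mulf_eq0 -fgh.
have : (size g + size h).-1 = 5%N by rewrite -size_mul // -fgh.
rewrite -/(often_smooth f) fgh in f0 *.
case eg: (size g) sg => [|[|[|[|[|n]]]]] // _; case eh: (size h) sh => [|[|[|[|[|k]]]]] // _ sz;
  try by move: sz; rewrite ?addnS ?addSn /=; lia.
- exact: linear_cubic_poly_smooth.
- have [l1 l2] : lead_coef g != 0 /\ lead_coef h != 0 by rewrite !lead_coef_eq0.
  rewrite lead_coefE eg /= in l1; rewrite lead_coefE eh /= in l2.
  apply: (quadratics_smooth _ g`_2 g`_1 g`_0 h`_2 h`_1 h`_0) => // n.
  rewrite hornerM !horner_coef eg eh !big_ord_recl !big_ord0 /=.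
  by rewrite !expr0 !mulr1 /bump /=; ring.
- by rewrite mulrC in f0 *; exact: linear_cubic_poly_smooth.
Qed.
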